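(* Let $G$ be a simple graph of $n$ vertices with no null vertex and let $F=\{f_i\}_{i\in[n]}$ be a $G(n,k)$-frame for $\mathbb{C}^k$. If $F$ is a tight frame, then $G$ is a regular graph.
   Context: $[n]=\{1,\dots,n\}$. A sequence $\{f_i\}_{i\in[n]}$ in $\mathbb{C}^k$ is a frame for $\mathbb{C}^k$ if there are constants $A,B>0$ with $A\|f\|^2\le\sum_{i\in[n]}|\langle f,f_i\rangle|^2\le B\|f\|^2$ for all $f\in\mathbb{C}^k$; it is a tight frame if one can take $A=B$. Its Gramian matrix is the $n\times n$ matrix whose $(i,j)$ entry is $\langle f_j,f_i\rangle$ (inner product linear in the first argument). The Laplacian matrix of a simple graph $G$ with vertices $v_1,\dots,v_n$ is $L(G)=D(G)-A(G)$, where $D(G)$ is the diagonal matrix of vertex degrees and $A(G)$ is the adjacency matrix. A frame $\{f_i\}_{i\in[n]}$ for $\mathbb{C}^k$ is a $G(n,k)$-frame if its Gramian matrix equals $L(G)$. A null vertex is a vertex of degree $0$. A graph is regular if all its vertices have the same degree. *)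

(* Defs.v *)
From HB Require Import structures.
From mathcomp Require Import all_boot all_order all_algebra spectral.
From mathcomp Require Import reals complex.

Set Implicit Arguments.
Unset Strict Implicit.
Unset Printing Implicit Defensive.

Import Order.TTheory GRing.Theory Num.Theory.
Local Open Scope ring_scope.
Local Open Scope complex_scope.

Record sgraph (n : nat) := SGraph {
  adj :> rel 'I_n;
  adj_sym : symmetric adj;
  adj_irr : irreflexive adj }.

Section Graphs.
Variable n : nat.
Implicit Type G : sgraph n.

Definition degree G (i : 'I_n) : nat := #|[set j | adj G i j]|.

Definition null_vertex G (i : 'I_n) : bool := degree G i == 0%N.

Definition regular_graph G : Prop := forall i j : 'I_n, degree G i = degree G j.

Definition degree_mx (K : nzRingType) G : 'M[K]_n :=
  diag_mx (\row_i (degree G i)%:R).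

Definition adjacency_mx (K : nzRingType) G : 'M[K]_n :=
  \matrix_(i, j) (adj G i j)%:R.

Definition laplacian_mx (K : nzRingType) G : 'M[K]_n :=
  degree_mx K G - adjacency_mx K G.

End Graphs.

(* The space C^k is 'rV[R[i]]_k with R a model of the real numbers; its inner
   product dotmx u v = \sum_l u_l * (v_l)^* is linear in u.  In the order of
   R[i], x <= y means that y - x is real and nonnegative, which on the
   real-valued sums below is the order of R. *)
Section Frames.
Variables (R : realType) (n k : nat).
Implicit Type f : 'I_n -> 'rV[R[i]]_k.

Definition frame_bounds f (A B : R) : Prop :=
  forall v : 'rV[R[i]]_k,
    A%:C * dotmx v v <= \sum_(i < n) `|dotmx v (f i)| ^+ 2 <= B%:C * dotmx v v.

Definition is_frame f : Prop :=
  exists A B : R, [/\ 0 < A, 0 < B & frame_bounds f A B].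

Definition is_tight_frame f : Prop :=
  exists A : R, 0 < A /\ frame_bounds f A A.

Definition gram_mx f : 'M[R[i]]_n := \matrix_(i, j) dotmx (f j) (f i).

Definition is_graph_frame (G : sgraph n) f : Prop :=
  is_frame f /\ gram_mx f = laplacian_mx R[i] G.

End Frames.

(* Main.v *)
Require Import Defs.
From mathcomp Require Import all_boot all_order all_algebra spectral.
From mathcomp Require Import reals complex.

Set Implicit Arguments.
Unset Strict Implicit.
Unset Printing Implicit Defensive.

Import Order.TTheory GRing.Theory Num.Theory.
Local Open Scope ring_scope.
Local Open Scope complex_scope.

(** The tight frame identity need only be tested on the frame vectors
    themselves.  With [v = F j], the coefficients [dotmx (F j) (F i)] are the
    entries of column [j] of the Gramian, which is the Laplacian.  That column
    holds the degree [d] of [j] on the diagonal and [d] entries equal to [-1],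
    so its squared norm is [d ^ 2 + d] ([sum_sqr_norm_laplacian_col]), while
    the squared norm of [F j] is the diagonal entry [d].  Tightness with bound
    [A] thus says [d ^ 2 + d = A * d]; as [d] is nonzero, [d = A - 1], a value
    that does not depend on [j]. *)

Lemma laplacian_mxE n (K : nzRingType) (G : sgraph n) i j :
  laplacian_mx K G i j = (degree G i)%:R *+ (i == j) - (adj G i j)%:R.
Proof. by rewrite !mxE. Qed.

Lemma laplacian_mx_diag n (K : nzRingType) (G : sgraph n) i :
  laplacian_mx K G i i = (degree G i)%:R.
Proof. by rewrite laplacian_mxE eqxx adj_irr subr0. Qed.

(** The diagonal entry and the adjacency entries have disjoint supports, since
    no vertex is adjacent to itself; no cross terms arise in the squares. *)
Lemma sum_sqr_norm_laplacian_col n (K : numDomainType) (G : sgraph n) j :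
  \sum_i `|laplacian_mx K G i j| ^+ 2
  = (degree G j)%:R ^+ 2 + (degree G j)%:R.
Proof.
rewrite (bigD1 j) //= laplacian_mx_diag normr_nat; congr (_ + _).
rewrite /degree -sum1_card natr_sum [RHS](bigID (pred1 j)) /=.
rewrite [X in _ = X + _]big1 ?add0r; last first.
  by move=> i /andP[+ /eqP ij]; rewrite inE ij adj_irr.
rewrite [RHS]big_mkcondl; apply: eq_bigr => i /negPf ij.
rewrite laplacian_mxE ij sub0r normrN normr_nat inE adj_sym.
by case: (adj G j i); rewrite ?expr1n ?expr0n.
Qed.

Lemma tight_frame_sum (R : realType) n k (F : 'I_n -> 'rV[R[i]]_k) A v :
  frame_bounds F A A ->
  \sum_(i < n) `|dotmx v (F i)| ^+ 2 = A%:C * dotmx v v.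
Proof. by move=> FA; apply/le_anti; rewrite andbC FA. Qed.

Lemma tight_graph_frame_degree (R : realType) n k (G : sgraph n)
    (F : 'I_n -> 'rV[R[i]]_k) A j :
  gram_mx F = laplacian_mx R[i] G -> frame_bounds F A A ->
  ~~ null_vertex G j -> (degree G j)%:R + 1 = A%:C.
Proof.
move=> gramF FA dj.
have dotF i : dotmx (F j) (F i) = laplacian_mx R[i] G i j.
  by rewrite -gramF mxE.
have := tight_frame_sum (F j) FA.
under eq_bigr do rewrite dotF.
rewrite sum_sqr_norm_laplacian_col dotF laplacian_mx_diag.
rewrite expr2 -[X in _ + X]mul1r -mulrDl.
by apply: mulIf; rewrite pnatr_eq0.
Qed.

Theorem theorem4p3 (R : realType) (n k : nat) (G : sgraph n)
    (F : 'I_n -> 'rV[complex R]_k) :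
  (forall i : 'I_n, ~~ null_vertex G i) ->
  is_graph_frame G F ->
  is_tight_frame F ->
  regular_graph G.
Proof.
move=> noNull [_ gramF] [A [_ FA]] i j.
have degA l := tight_graph_frame_degree gramF FA (noNull l).
have : (degree G i)%:R + 1 = (degree G j)%:R + 1 :> R[i] by rewrite !degA.
by move/addIr/eqP; rewrite eqr_nat => /eqP.
Qed.
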